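(* Let $0<|q|<1$ and let $b,c\in\mathbb{C}\setminus\{0\}$ with $|b^2q^2|<|c|$. Then \[ \sum_{i,j,k\geq0}\frac{(-1)^{i+j}b^{-i+j}c^{i-j+k}q^{(i^{2}+(i-j+2k)^{2}-2i+3j-2k)/2}}{(q;q)_{i}(q;q)_{j}(q^{2};q^{2})_{k}}=\frac{(-q,bq^{2}/c;q)_{\infty}(bq,c/b;q^{2})_{\infty}}{(b^{2}q^{2}/c;q^{2})_{\infty}}. \]
   Context: For $a\in\mathbb{C}$ and $|p|<1$: $(a;p)_0=1$, $(a;p)_n=\prod_{k=0}^{n-1}(1-ap^k)$, $(a;p)_\infty=\prod_{k\ge0}(1-ap^k)$, and $(a_1,\dots,a_m;p)_\infty=\prod_{r=1}^m(a_r;p)_\infty$. *)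

(* Defs.v *)
From mathcomp Require Import all_boot all_order all_algebra.
From mathcomp Require Import finmap complex.
From mathcomp Require Import all_classical all_reals all_analysis.
From mathcomp Require Import ring zify.
From mathcomp Require summability.

Set Implicit Arguments.
Unset Strict Implicit.
Unset Printing Implicit Defensive.

Import Order.TTheory GRing.Theory Num.Theory.
Import numFieldNormedType.Exports.

Local Open Scope classical_set_scope.
Local Open Scope ring_scope.

(* The carrier [R[i]] has no topology of its own in the library; its usual
   (norm) topology is carried by the regular module [R[i]^o], hence the casts
   to [R[i]^o] wherever a limit is taken. *)

Definition qpoch {R : realType} (a p : R[i]) (n : nat) : R[i] :=
  \prod_(k < n) (1 - a * p ^+ k).

Definition qpoch_infty {R : realType} (a p : R[i]) : R[i] :=
  lim ((fun n : nat => qpoch a p n : R[i]^o) @ \oo).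

Definition qpochs_infty {R : realType} (s : seq R[i]) (p : R[i]) : R[i] :=
  \prod_(a <- s) qpoch_infty a p.

(* Unconditional (equivalently, over the complex numbers, absolute) convergence
   of the family [f] with sum [l]: the sums over finite sets of indices converge
   to [l] along the finite sets ordered by inclusion. *)
Definition has_sum {R : realType} {I : choiceType} (f : I -> R[i]) (l : R[i]) :
  Prop :=
  (summability.partial_sum f : {fset I} -> R[i]^o) @ summability.totally
    --> (l : R[i]^o).

Definition qexp_num (i j k : nat) : int :=
  i%:Z ^+ 2 + (i%:Z - j%:Z + 2 * k%:Z) ^+ 2 - 2 * i%:Z + 3 * j%:Z - 2 * k%:Z.

(* [(_ %/ _)%Z] is a Euclidean quotient; it is exact here by [qexpE]. *)
Definition qexp (i j k : nat) : int := (qexp_num i j k %/ 2)%Z.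

Lemma qexpE (i j k : nat) : qexp_num i j k = qexp i j k * 2.
Proof.
apply/esym/divzK; rewrite /qexp_num.
have -> : i%:Z ^+ 2 + (i%:Z - j%:Z + 2 * k%:Z) ^+ 2 - 2 * i%:Z + 3 * j%:Z
    - 2 * k%:Z = (i%:Z ^+ 2 + 2 * k%:Z ^+ 2 + 2 * i%:Z * k%:Z
    - 2 * j%:Z * k%:Z - i%:Z * j%:Z - i%:Z + j%:Z - k%:Z) * 2
    + j%:Z * (j%:Z + 1) by ring.
have -> : j%:Z * (j%:Z + 1) = (j * j.+1)%N%:Z by lia.
by rewrite rpredD ?dvdz_mull // dvdzE !absz_nat dvdn2 oddM /= andbN.
Qed.

Definition triple_term {R : realType} (q b c : R[i]) (x : nat * nat * nat) :
  R[i] :=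
  let: (i, j, k) := x in
  (-1) ^+ (i + j) * b ^ (- i%:Z + j%:Z) * c ^ (i%:Z - j%:Z + k%:Z)
    * q ^ (qexp i j k)
  / (qpoch q q i * qpoch q q j * qpoch (q ^+ 2) (q ^+ 2) k).

(* Main.v *)
Require Import Defs.
From mathcomp Require Import all_boot all_order all_algebra.
From mathcomp Require Import finmap complex.
From mathcomp Require Import all_classical all_reals all_analysis.
From mathcomp Require Import ring zify.
From mathcomp Require summability.

Import Order.TTheory GRing.Theory Num.Theory.
Import numFieldNormedType.Exports.
Local Open Scope classical_set_scope.
Local Open Scope complex_scope.
Local Open Scope ring_scope.

(* Put [beta = b q^2 / c], [z = b^2 q^2 / c] and [N = i + 2k]. Up to a factor
   independent of [j], the [j]-sum is Euler's expansion of
   [(beta q^(-N); q)_oo], which contributes [(q/beta; q)_N (beta; q)_oo]. The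
   [i]-sum is then Lebesgue's identity
   [sum_i q^(i(i+1)/2) (A; q)_i / (q; q)_i = (-q; q)_oo (A q; q^2)_oo], and the
   [k]-sum is the q-binomial theorem in base [q^2]. The terms are dominated by
   those of the same sum at the parameters [|q|], [-|beta|], [|z|], which are
   nonnegative and have convergent iterated sums by the same three identities;
   this justifies the rearrangement by dominated convergence. *)

(** * Limits of complex sequences and completeness *)

Definition tends {R : realType} (u : nat -> R[i]) (l : R[i]) : Prop :=
  (u : nat -> R[i]^o) @ \oo --> (l : R[i]^o).

Lemma tendsP {R : realType} {u : nat -> R[i]} {l : R[i]} :
  tends u l <-> forall e : R[i], 0 < e ->
    exists N, forall n, (N <= n)%N -> `|u n - l| < e.
Proof.
split=> [/cvgrPdist_lt h e e0|h].
  by have [N _ hN] := h e e0; exists N => n Nn; rewrite distrC; exact: hN.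
apply/cvgrPdist_lt => e e0; have [N hN] := h e e0.
by exists N => // n Nn; rewrite distrC; exact: hN.
Qed.

Lemma tends_lim {R : realType} {u : nat -> R[i]} {l : R[i]} :
  tends u l -> lim ((u : nat -> R[i]^o) @ \oo) = l.
Proof. by move=> hu; exact: cvg_lim. Qed.

Lemma tends_uniq {R : realType} {u : nat -> R[i]} {l m : R[i]} :
  tends u l -> tends u m -> l = m.
Proof.
by move=> hu hv; exact: (etrans (esym (tends_lim hu)) (tends_lim hv)).
Qed.

Lemma tends_cst {R : realType} (l : R[i]) : tends (fun=> l) l.
Proof. exact: cvg_cst. Qed.

Lemma tendsN {R : realType} {u : nat -> R[i]} {l : R[i]} :
  tends u l -> tends (fun n => - u n) (- l).
Proof. by move=> hu; exact: (cvgN hu). Qed.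

Lemma tendsD {R : realType} {u v : nat -> R[i]} {l m : R[i]} :
  tends u l -> tends v m -> tends (fun n => u n + v n) (l + m).
Proof. by move=> hu hv; exact: (cvgD hu hv). Qed.

Lemma tendsM {R : realType} {u v : nat -> R[i]} {l m : R[i]} :
  tends u l -> tends v m -> tends (fun n => u n * v n) (l * m).
Proof. by move=> hu hv; exact: (cvgM hu hv). Qed.

Lemma tendsV {R : realType} {u : nat -> R[i]} {l : R[i]} :
  l != 0 -> tends u l -> tends (fun n => (u n)^-1) l^-1.
Proof. by move=> l0 hu; exact: (cvgV l0 hu). Qed.

Lemma tends_norm {R : realType} {u : nat -> R[i]} {l : R[i]} :
  tends u l -> tends (fun n => `|u n|) `|l|.
Proof. by move=> hu; exact: (cvg_norm hu). Qed.

(** Completeness is inherited from the reals: real and imaginary parts are additive and bounded by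
    the norm, so both are Cauchy, and their limits are recombined. *)
Lemma tends_cauchy {R : realType} {u : nat -> R[i]} :
  (forall e : R[i], 0 < e -> exists N, forall m n, (N <= m)%N -> (N <= n)%N ->
     `|u m - u n| < e) ->
  exists l, tends u l.
Proof.
move=> cu.
have real_part (p : R[i] -> R) : {morph p : x y / x - y} ->
    (forall x, `|p x|%:C <= `|x|) ->
    exists a : R, (p \o u) @ \oo --> a.
  move=> pB ple; apply/cvg_ex/cauchy_cvgP/cauchy_exP => e e0.
  have [|N hN] := cu e%:C; first by rewrite ltcR.
  exists (p (u N)); exists N => // n /= Nn; rewrite /ball /= -pB -ltcR.
  by apply: le_lt_trans (ple _) _; exact: hN.
have [|a ha] := @real_part (@complex.Re R) _ (@normc_ge_Re R).
  by move=> [? ?] [? ?].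
have [||b hb] := real_part (@complex.Im R).
- by move=> [? ?] [? ?].
- move=> x; rewrite normc_def lecR -sqrtr_sqr ler_sqrt.
    by rewrite lerDr sqr_ge0.
  by rewrite addr_ge0 ?sqr_ge0.
exists (a +i* b)%C; apply/tendsP => e.
case: e => e1 e2; rewrite ltcE /= => /andP[/eqP -> e0].
have e20 : 0 < e1 / 2 by rewrite divr_gt0.
have /cvgrPdist_lt/(_ _ e20)[N1 _ h1] := ha.
have /cvgrPdist_lt/(_ _ e20)[N2 _ h2] := hb.
exists (maxn N1 N2) => n; rewrite geq_max => /andP[n1 n2].
have {}h1 := h1 n n1; have {}h2 := h2 n n2.
move: h1 h2; rewrite /= distrC [X in _ -> X < _ -> _]distrC.
case: (u n) => x y /= h1 h2.
have -> : ((x +i* y) - (a +i* b))%C = (x - a)%:C + 'i%C * (y - b)%:C :> R[i].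
  by rewrite [LHS]complexE.
have norm_real (t : R) : `|t%:C| = `|t|%:C.
  by rewrite normc_def /= expr0n addr0 sqrtr_sqr.
apply: le_lt_trans (ler_normD _ _) _; rewrite normrM complexiE normCi mul1r.
rewrite !norm_real -rmorphD /= ltcR [ltRHS](splitr e1).
exact: ltrD.
Qed.

(** * Series, domination and exchange of limits *)

Definition sums {R : realType} (u : nat -> R[i]) (l : R[i]) : Prop :=
  tends (fun n => \sum_(i < n) u i) l.

Lemma tends_shift {R : realType} {u : nat -> R[i]} {l : R[i]} :
  tends u l -> tends (fun n => u n.+1) l.
Proof. by rewrite /tends => hu; rewrite (cvg_shiftS (u : nat -> R[i]^o)). Qed.

Lemma tends_near {R : realType} {u v : nat -> R[i]} {l : R[i]} {N : nat} :
  (forall n, (N <= n)%N -> u n = v n) -> tends u l -> tends v l.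
Proof.
move=> uv /tendsP hu; apply/tendsP => e /hu[N' hN'].
exists (maxn N N') => n; rewrite geq_max => /andP[n1 n2].
by rewrite -uv //; exact: hN'.
Qed.

Lemma tends_ext {R : realType} {u v : nat -> R[i]} {l : R[i]} :
  u =1 v -> tends u l -> tends v l.
Proof. by move=> uv; apply: (@tends_near _ _ _ _ 0). Qed.

Lemma tends_sum {R : realType} {u : nat -> nat -> R[i]} {v : nat -> R[i]}
    (N : nat) :
  (forall i, tends (u^~ i) (v i)) ->
  tends (fun n => \sum_(i < N) u n i) (\sum_(i < N) v i).
Proof.
move=> huv; elim: N => [|N IH].
  by rewrite big_ord0; apply: tends_ext (tends_cst 0) => n; rewrite big_ord0.
rewrite big_ord_recr /=.
apply: (tends_ext _ (tendsD IH (huv N))) => n.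
by rewrite big_ord_recr.
Qed.

Lemma tends_ge0 {R : realType} {u : nat -> R[i]} {l : R[i]} :
  (forall n, 0 <= u n) -> tends u l -> 0 <= l.
Proof.
move=> u0 hu; rewrite (tends_uniq hu (tends_ext _ (tends_norm hu))) //.
by move=> n; rewrite ger0_norm.
Qed.

(** A norm in [R[i]] is a complex number with zero imaginary part, so the decay reduces to that of
    powers of a real number. *)
Lemma tends_expr0 {R : realType} {x : R[i]} :
  `|x| < 1 -> tends (fun n => x ^+ n) 0.
Proof.
move=> x1; have xE : `|x| = (complex.Re `|x|)%:C by rewrite normc_def.
have x0 : 0 <= complex.Re `|x|.
  by have := normr_ge0 x; rewrite xE lecE => /andP[].
have x1' : `|complex.Re `|x| | < 1.
  by rewrite ger0_norm //; move: x1; rewrite xE ltcE => /andP[].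
apply/tendsP => e; case: e => e1 e2; rewrite ltcE /= => /andP[/eqP -> e0].
have /cvgrPdist_lt/(_ _ e0)[N _ hN] := cvg_expr x1'.
exists N => n Nn; have := hN n Nn; rewrite /= sub0r normrN subr0.
have -> : `|x ^+ n| = `|complex.Re `|x| ^+ n|%:C.
  by rewrite normrX [in LHS]xE -rmorphXn /= ger0_norm // exprn_ge0.
by rewrite ltcR.
Qed.

Lemma tends_geometric0 {R : realType} {x : R[i]} (y : R[i]) :
  `|x| < 1 -> tends (fun n => x ^+ n * y) 0.
Proof.
by move=> x1; rewrite -(mul0r y); exact: tendsM (tends_expr0 x1) (tends_cst _).
Qed.

Lemma sums_ext {R : realType} {u v : nat -> R[i]} {l : R[i]} :
  u =1 v -> sums u l -> sums v l.
Proof. by move=> uv; apply: tends_ext => n; apply: eq_bigr. Qed.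

Lemma sumsZ {R : realType} {a : R[i]} {u : nat -> R[i]} {l : R[i]} :
  sums u l -> sums (fun n => a * u n) (a * l).
Proof.
move=> hu; apply: (tends_ext _ (tendsM (tends_cst a) hu)) => n.
by rewrite mulr_sumr.
Qed.

Lemma sums_ge_partial {R : realType} {u : nat -> R[i]} {l : R[i]} (n : nat) :
  (forall i, 0 <= u i) -> sums u l -> \sum_(i < n) u i <= l.
Proof.
move=> u0 hu; rewrite -subr_ge0.
have h := tendsD hu (tendsN (tends_cst (\sum_(i < n) u i))).
(* Cutting at [maxn m n] makes the difference nonnegative for every [m] without changing its
   limit. *)
apply: (tends_ge0 (u := fun m => \sum_(i < maxn m n) u i - \sum_(i < n) u i)).
  move=> m; have /subnKC <- := leq_maxr m n.
  by rewrite big_split_ord /= [X in X - _]addrC addrK sumr_ge0.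
by apply: (tends_near (N := n) _ h) => m /maxn_idPl ->.
Qed.

(** The rank [N] depends on [M] and [e] only; this uniformity over all dominated [u] is what
    [tannery] requires. *)
Lemma sums_tail {R : realType} {M : nat -> R[i]} {S : R[i]} :
  sums M S -> forall e : R[i], 0 < e -> exists N, forall u : nat -> R[i],
    (forall i, `|u i| <= M i) ->
    forall m n, (N <= m)%N -> (N <= n)%N ->
    `|\sum_(i < m) u i - \sum_(i < n) u i| < e.
Proof.
move=> /tendsP hM e e0; have [|N hN] := hM (e / 2); first by rewrite divr_gt0.
exists N => u uM m n Nm Nn; wlog nm : m n Nm Nn / (n <= m)%N.
  by move=> H; case/orP: (leq_total n m) => nm; [|rewrite distrC]; exact: H.
have uE (v : nat -> R[i]) :
    \sum_(i < m) v i - \sum_(i < n) v i = \sum_(n <= i < m) v i.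
  rewrite -!(big_mkord predT) (big_cat_nat (leq0n n) nm) //=.
  by rewrite [X in X - _]addrC addrK.
rewrite uE; apply: le_lt_trans (ler_norm_sum _ _ _) _.
apply: (@le_lt_trans _ _ (\sum_(n <= i < m) M i)).
  by apply: ler_sum.
apply: (@le_lt_trans _ _ `|\sum_(n <= i < m) M i|).
  by rewrite ger0_norm // sumr_ge0 // => i _; apply: le_trans (uM i).
rewrite -uE [ltRHS](splitr e).
have -> : \sum_(i < m) M i - \sum_(i < n) M i =
  (\sum_(i < m) M i - S) - (\sum_(i < n) M i - S) by ring.
by apply: le_lt_trans (ler_normB _ _) _; rewrite ltrD // hN.
Qed.

Lemma sums_dominated {R : realType} {u M : nat -> R[i]} {S : R[i]} :
  (forall i, `|u i| <= M i) -> sums M S -> exists l, sums u l.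
Proof.
move=> uM hM; apply: tends_cauchy => e e0.
by have [N hN] := sums_tail hM _ e0; exists N => m n; exact: hN.
Qed.

(** Dominated convergence for series. The tails beyond a fixed [N] are small uniformly in [n], the
    first [N] terms converge one by one, and [U n] is replaced by a partial sum whose length depends
    on [n]; each of the four errors is below a quarter of [e]. *)
Lemma tannery {R : realType} {u : nat -> nat -> R[i]} {v M U : nat -> R[i]}
    {S V : R[i]} :
  sums M S -> (forall n i, `|u n i| <= M i) ->
  (forall i, tends (u^~ i) (v i)) -> (forall n, sums (u n) (U n)) ->
  sums v V -> tends U V.
Proof.
move=> hM uM uv uU /tendsP vV; apply/tendsP => e e0.
have e40 : 0 < e / 2 / 2 by rewrite !divr_gt0.
have [N1 hN1] := sums_tail hM _ e40.
have [N2 hN2] := vV _ e40.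
pose N := maxn N1 N2.
have [N3 hN3] := tendsP.1 (tends_sum N uv) _ e40.
exists N3 => n N3n.
have [N4 hN4] := tendsP.1 (uU n) _ e40.
pose m := maxn N1 N4.
have h1 : `|\sum_(i < m) u n i - U n| < e / 2 / 2.
  by apply: hN4; rewrite leq_maxr.
have h2 : `|\sum_(i < m) u n i - \sum_(i < N) u n i| < e / 2 / 2.
  by apply: hN1; rewrite ?leq_maxl.
have h3 := hN3 n N3n.
have h4 : `|\sum_(i < N) v i - V| < e / 2 / 2 by apply: hN2; rewrite leq_maxr.
have -> : U n - V = ((\sum_(i < m) u n i - \sum_(i < N) u n i)
    - (\sum_(i < m) u n i - U n))
    + ((\sum_(i < N) u n i - \sum_(i < N) v i) + (\sum_(i < N) v i - V)).
  by ring.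
apply: le_lt_trans (ler_normD _ _) _; rewrite [ltRHS](splitr e).
apply: ltrD.
  apply: le_lt_trans (ler_normB _ _) _; rewrite [ltRHS](splitr (e / 2)).
  exact: ltrD.
apply: le_lt_trans (ler_normD _ _) _; rewrite [ltRHS](splitr (e / 2)).
exact: ltrD.
Qed.

Lemma sums_geometric {R : realType} {x : R[i]} :
  `|x| < 1 -> sums (fun n => x ^+ n) (1 - x)^-1.
Proof.
move=> x1; have x1' : 1 - x != 0.
  by rewrite subr_eq0; apply: contraTneq x1 => <-; rewrite normr1 ltxx.
have h : tends (fun n => (1 - x ^+ n) / (1 - x)) ((1 - 0) / (1 - x)).
  apply: tendsM (tends_cst _); apply: tendsD (tends_cst _) (tendsN _).
  exact: tends_expr0.
rewrite subr0 mul1r in h; apply: (tends_ext _ h) => n.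
by rewrite -opprB subrX1 -mulNr opprB mulrC mulKf.
Qed.

(** The recurrence form avoids dividing by terms, which may vanish. Beyond some rank the ratios are
    at most [rho], halfway between the norm of [l] and 1, which gives a geometric majorant. *)
Lemma ratio_test {R : realType} {u r : nat -> R[i]} {l : R[i]} :
  (forall n, u n.+1 = r n * u n) -> tends r l -> `|l| < 1 ->
  exists S, sums (fun n => `|u n|) S.
Proof.
move=> ur /tendsP hr l1; pose rho := (1 + `|l|) / 2.
have rho0 : 0 < rho by rewrite divr_gt0 // ltr_pwDl.
have rho1 : rho < 1 by rewrite /rho ltr_pdivrMr // mul1r -[2]/(1 + 1) ltrD2l.
have [|N hN] := hr (rho - `|l|).
  rewrite /rho subr_gt0 ltr_pdivlMr // mulrDr mulr1 ltrD2r.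
  exact: l1.
have rN n : (N <= n)%N -> `|r n| <= rho.
  move=> Nn; rewrite -[r n](subrK l); apply: le_trans (ler_normD _ _) _.
  by rewrite -lerBrDr ltW // hN.
(* Summing over all initial indices bounds each of them: the matching summand suffices and the
   others are nonnegative. *)
pose C := \sum_(i < N.+1) `|u i| / rho ^+ i.
have uC n : `|u n| <= C * rho ^+ n.
  have small k : (k <= N)%N -> `|u k| <= C * rho ^+ k.
    move=> kN; rewrite -ler_pdivrMr ?exprn_gt0 //.
    rewrite /C (bigD1 (Ordinal (kN : (k < N.+1)%N))) //= lerDl.
    rewrite sumr_ge0 // => i _.
    by rewrite divr_ge0 // exprn_ge0 // ltW.
  have [/small //|/ltnW Nn] := leqP n N.
  rewrite -(subnKC Nn); elim: (n - N)%N => [|k IH].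
    by rewrite addn0 small.
  rewrite addnS ur normrM exprS mulrCA.
  by apply: ler_pM => //; exact: rN (leq_addr _ _).
apply: (sums_dominated (M := fun n => C * rho ^+ n)).
  by move=> i; rewrite normr_id.
apply: sumsZ; apply: sums_geometric; rewrite gtr0_norm //.
Qed.

Lemma sums_abs {R : realType} {u : nat -> R[i]} {S : R[i]} :
  sums (fun n => `|u n|) S -> exists l, sums u l.
Proof. exact: sums_dominated. Qed.

Lemma tends_divl {R : realType} {u v : nat -> R[i]} {l m : R[i]} :
  m != 0 -> tends (fun n => u n * v n) l -> tends v m -> tends u (l / m).
Proof.
move=> m0 huv hv; have m0' : 0 < `|m| by rewrite normr_gt0.
have [N hN] := tendsP.1 hv _ m0'.
apply: (@tends_near _ _ _ _ N _ (tendsM huv (tendsV m0 hv))) => n Nn.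
rewrite mulfK //; apply: contraTneq (hN n Nn) => ->.
by rewrite sub0r normrN ltxx.
Qed.

Lemma sums_terms0 {R : realType} {u : nat -> R[i]} {l : R[i]} :
  sums u l -> tends u 0.
Proof.
move=> hu; rewrite -(subrr l).
apply: tends_ext (tendsD (tends_shift hu) (tendsN hu)) => n.
by rewrite big_ord_recr /= addrAC subrr add0r.
Qed.

(** * Finite q-Pochhammer products and the series [phi_term] *)

Lemma qpochS {R : realType} (a q : R[i]) n :
  qpoch a q n.+1 = qpoch a q n * (1 - a * q ^+ n).
Proof. by rewrite /qpoch big_ord_recr. Qed.

Lemma qpoch0 {R : realType} (a q : R[i]) : qpoch a q 0 = 1.
Proof. by rewrite /qpoch big_ord0. Qed.

Lemma qpochD {R : realType} (a q : R[i]) m n :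
  qpoch a q (m + n) = qpoch a q m * qpoch (a * q ^+ m) q n.
Proof.
rewrite /qpoch big_split_ord; congr (_ * _).
by apply: eq_bigr => i _; rewrite /= exprD mulrA.
Qed.

Lemma qpochSl {R : realType} (a q : R[i]) n :
  qpoch a q n.+1 = (1 - a) * qpoch (a * q) q n.
Proof. by rewrite -add1n qpochD qpochS qpoch0 !expr1 mul1r expr0 mulr1. Qed.

Lemma one_sub_neq0 {R : realType} {x : R[i]} : `|x| < 1 -> 1 - x != 0.
Proof.
by move=> x1; rewrite subr_eq0; apply: contraTneq x1 => <-; rewrite normr1 ltxx.
Qed.

Lemma norm_exprS_lt1 {R : realType} {q : R[i]} n : `|q| < 1 -> `|q ^+ n.+1| < 1.
Proof. by move=> q1; rewrite normrX exprn_ilt1. Qed.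

Lemma qpoch_neq0 {R : realType} {q : R[i]} n : `|q| < 1 -> qpoch q q n != 0.
Proof.
move=> q1; apply/prodf_neq0 => i _.
by rewrite -exprS one_sub_neq0 ?norm_exprS_lt1.
Qed.

(** Negating the norm of [a] turns each factor into a sum, the bound of the triangle inequality;
    this is why majorants carry a negated parameter. *)
Lemma norm_qpoch_le {R : realType} (a q : R[i]) n :
  `|qpoch a q n| <= qpoch (- `|a|) `|q| n.
Proof.
rewrite /qpoch normr_prod; apply: ler_prod => i _; rewrite normr_ge0 /=.
by apply: le_trans (ler_normB _ _) _; rewrite normr1 mulNr opprK normrM normrX.
Qed.

Lemma qpoch_norm_gt0 {R : realType} {q : R[i]} n :
  `|q| < 1 -> 0 < qpoch `|q| `|q| n.
Proof.
move=> q1; apply: prodr_gt0 => i _.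
by rewrite -exprS subr_gt0 exprn_ilt1.
Qed.

Lemma norm_qpoch_ge {R : realType} {q : R[i]} n :
  `|q| < 1 -> qpoch `|q| `|q| n <= `|qpoch q q n|.
Proof.
move=> q1; rewrite /qpoch normr_prod; apply: ler_prod => i _.
rewrite -!exprS subr_ge0 exprn_ile1 //= ?(ltW q1) //.
by apply: le_trans (lerB_normD _ _); rewrite normrN normr1 normrX.
Qed.

(* The series is Euler's for [a = 0], [p = q], the q-binomial one for [p = 1],
   and Lebesgue's for [x = p = q]. *)
Definition phi_term {R : realType} (a x p q : R[i]) (n : nat) : R[i] :=
  qpoch a q n / qpoch q q n * (p ^+ 'C(n, 2) * x ^+ n).

Lemma phi_term0 {R : realType} (a x p q : R[i]) : phi_term a x p q 0 = 1.
Proof. by rewrite /phi_term !qpoch0 bin0n !expr0 invr1 !mulr1. Qed.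

Lemma phi_termS {R : realType} {a x p q : R[i]} n : `|q| < 1 ->
  phi_term a x p q n.+1 =
  (1 - a * q ^+ n) / (1 - q ^+ n.+1) * (p ^+ n * x) * phi_term a x p q n.
Proof.
move=> q1; rewrite /phi_term !qpochS binS bin1 exprD exprS -exprS.
have h1 := one_sub_neq0 (norm_exprS_lt1 n q1); have h2 := qpoch_neq0 n q1.
by field; rewrite h1 h2.
Qed.

(** The factors in [a] and [q] of the ratio tend to 1, so consecutive terms have limiting ratio [l],
    which is 0 in the Euler and Lebesgue cases and [x] for [p = 1]. *)
Lemma phi_term_summable {R : realType} {a x p q l : R[i]} :
  `|q| < 1 -> tends (fun n => p ^+ n * x) l -> `|l| < 1 ->
  exists S, sums (fun n => `|phi_term a x p q n|) S.
Proof.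
move=> q1 hl l1; apply: (ratio_test (fun n => phi_termS n q1) _ l1).
have -> : l = (1 - a * 0) / (1 - 0) * l by rewrite mulr0 subr0 divr1 mul1r.
apply: tendsM _ hl; apply: tendsM; last apply: tendsV.
- apply: tendsD (tends_cst _) (tendsN (tendsM (tends_cst _) _)).
  exact: tends_expr0.
- by rewrite subr0 oner_neq0.
- apply: tendsD (tends_cst _) (tendsN _).
  exact: tends_shift (tends_expr0 q1).
Qed.

(** The bounds [b] and [y] are kept apart from [a] and [x] so that one majorant serves a whole
    sequence of parameters. *)
Lemma phi_term_norm_le {R : realType} {a b x y : R[i]} (p : R[i]) {q : R[i]} n :
  `|q| < 1 -> `|a| <= `|b| -> `|x| <= `|y| ->
  `|phi_term a x p q n| <= phi_term (- `|b|) `|y| `|p| `|q| n.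
Proof.
move=> q1 ab xy; rewrite /phi_term !normrM normfV !normrX.
apply: ler_pM; rewrite ?divr_ge0 ?mulr_ge0 ?exprn_ge0 //.
  apply: ler_pM; rewrite ?invr_ge0 //.
    apply: le_trans (norm_qpoch_le _ _ _) _; apply: ler_prod => i _.
    rewrite !mulNr !opprK addr_ge0 ?mulr_ge0 ?exprn_ge0 //=.
    by rewrite lerD2l ler_wpM2r // exprn_ge0.
  rewrite lef_pV2 ?posrE ?qpoch_norm_gt0 ?normr_gt0 ?qpoch_neq0 //.
  exact: norm_qpoch_ge.
by apply: ler_wpM2l; rewrite ?exprn_ge0 // lerXn2r ?nnegrE.
Qed.

Lemma phi_sum_tends {R : realType} {a x U : nat -> R[i]}
    {b y p q a0 x0 l V : R[i]} :
  `|q| < 1 -> tends (fun n => `|p| ^+ n * `|y|) l -> `|l| < 1 ->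
  (forall n, `|a n| <= `|b|) -> (forall n, `|x n| <= `|y|) ->
  tends a a0 -> tends x x0 ->
  (forall n, sums (phi_term (a n) (x n) p q) (U n)) ->
  sums (phi_term a0 x0 p q) V -> tends U V.
Proof.
move=> q1 hl l1 ab xy ha hx hU hV.
have q1' : `| `|q| | < 1 by rewrite normr_id.
have [S hS] := phi_term_summable (a := - `|b|) q1' hl l1.
apply: (tannery hS _ _ hU hV) => [n i|i].
  apply: le_trans (phi_term_norm_le p i q1 (ab n) (xy n)) _.
  (* The majorant is nonnegative because it bounds a norm, so it equals its own norm, the form in
     which summability is known. *)
  have := phi_term_norm_le p i q1 (lexx `|b|) (lexx `|y|).
  by move/(le_trans (normr_ge0 _))/ger0_norm ->.
elim: i {hU hV hS S} => [|i IH].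
  by rewrite phi_term0; apply: tends_ext (tends_cst 1) => n; rewrite phi_term0.
have h1 := tendsD (tends_cst 1) (tendsN (tendsM ha (tends_cst (q ^+ i)))).
have h2 := tendsM h1 (tends_cst (1 - q ^+ i.+1)^-1).
have h3 := tendsM (tendsM h2 (tendsM (tends_cst (p ^+ i)) hx)) IH.
move: (phi_termS (a := a0) (x := x0) (p := p) i q1) => ->.
by apply: tends_ext h3 => n; rewrite -phi_termS.
Qed.

(** * Infinite products: Euler's identity, the q-binomial theorem and Lebesgue's identity *)

Lemma qpoch_infty_lim {R : realType} {a q l : R[i]} :
  tends (qpoch a q) l -> qpoch_infty a q = l.
Proof. exact: tends_lim. Qed.

(* The sum [E] satisfies [E x = (1 + x) * E (x * q)], hence
   [E x = qpoch (- x) q n * E (x * q ^+ n)]; let [n] tend to infinity. *)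
Lemma euler {R : realType} (x : R[i]) {q : R[i]} : `|q| < 1 ->
  sums (phi_term 0 x q q) (qpoch_infty (- x) q) /\
  tends (qpoch (- x) q) (qpoch_infty (- x) q).
Proof.
move=> q1.
have nlt : `|0 : R[i]| < 1 by rewrite normr0 ltr01.
have /choice[E hE] : forall y, exists l, sums (phi_term 0 y q q) l.
  move=> y.
  have [S hS] := phi_term_summable (a := 0) q1 (tends_geometric0 y q1) nlt.
  exact: sums_abs hS.
have step y : E y = (1 + y) * E (y * q).
  rewrite mulrDl mul1r; apply: tends_uniq (tends_shift (hE y)) _.
  (* The functional equation is exact on partial sums: [n + 1] terms at [y] equal [n + 1] terms at
     [y * q] plus [y] times the first [n] of these. *)
  have h' := tendsD (tends_shift (hE (y * q)))
    (tendsM (tends_cst y) (hE (y * q))).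
  apply: tends_ext h' => n; rewrite mulr_sumr.
  elim: n => [|n IH].
    by rewrite !big_ord_recr !big_ord0 /= addr0 !phi_term0.
  rewrite big_ord_recr [in RHS]big_ord_recr /= -IH.
  rewrite [X in _ + X = _]big_ord_recr /=.
  rewrite addrACA; congr (_ + _).
  have h1 := one_sub_neq0 (norm_exprS_lt1 n q1); have h2 := qpoch_neq0 n q1.
  rewrite !phi_termS // /phi_term !exprMn !mul0r subr0 exprS.
  by rewrite exprS in h1; field; rewrite h1 h2.
have expand n y : E y = qpoch (- y) q n * E (y * q ^+ n).
  elim: n y => [|n IH] y; first by rewrite qpoch0 mul1r mulr1.
  rewrite step IH qpochSl opprK mulNr exprS !mulrA.
  by congr (_ * _).
have E0 : E 0 = 1.
  apply: tends_uniq (tends_shift (hE 0)) _; apply: tends_ext (tends_cst 1) => n.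
  rewrite big_ord_recl phi_term0 big1 ?addr0 // => i _.
  by rewrite /phi_term lift0 expr0n /= !mulr0.
have lim1 : tends (fun n => E (x * q ^+ n)) 1.
  apply: (phi_sum_tends (a := fun=> 0) (b := 0) (x := fun n => x * q ^+ n)
    (y := x) (p := q) (q := q) (a0 := 0) (x0 := 0) (l := 0)) => //.
  - by apply: tends_geometric0; rewrite normr_id.
  - by move=> n; rewrite normrM normrX ler_piMr // exprn_ile1 // ltW.
  - exact: tends_cst.
  - by rewrite -(mulr0 x); apply: tendsM (tends_cst _) (tends_expr0 q1).
  - by rewrite -E0; exact: hE.
(* Convergence of the product is itself obtained here: its product with a factor tending to 1 is the
   constant [E x]. *)
have h : tends (qpoch (- x) q) (E x).
  rewrite -[E x]divr1; apply: (tends_divl (oner_neq0 _) _ lim1).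
  by apply: tends_ext (tends_cst (E x)) => n; rewrite -expand.
by move: (qpoch_infty_lim h) => ->; split; [exact: hE | exact: h].
Qed.

Lemma qpoch_tends {R : realType} (a : R[i]) {q : R[i]} : `|q| < 1 ->
  tends (qpoch a q) (qpoch_infty a q).
Proof. by move=> q1; have [_] := euler (- a) q1; rewrite opprK. Qed.

Lemma qpoch_infty0 {R : realType} {q : R[i]} : qpoch_infty 0 q = 1.
Proof.
apply: qpoch_infty_lim; apply: tends_ext (tends_cst 1) => n.
by rewrite /qpoch big1 // => i _; rewrite mul0r subr0.
Qed.

(* The sum [B] satisfies [(1 - z) * B z = (1 - a * z) * B (z * q)]. *)
Lemma qbinomial_mul {R : realType} (a : R[i]) {q z : R[i]} :
  `|q| < 1 -> `|z| < 1 ->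
  exists2 S, sums (phi_term a z 1 q) S &
    qpoch_infty z q * S = qpoch_infty (a * z) q.
Proof.
move=> q1 z1.
have dec (y : R[i]) : tends (fun n => 1 ^+ n * y) y.
  by apply: tends_ext (tends_cst y) => n; rewrite expr1n mul1r.
have /choice[B hB] : forall n, exists l, sums (phi_term a (z * q ^+ n) 1 q) l.
  move=> n; have [|S hS] := phi_term_summable (a := a) q1 (dec (z * q ^+ n)).
    rewrite normrM normrX; apply: le_lt_trans z1.
    by rewrite ler_piMr // exprn_ile1 // ltW.
  exact: sums_abs hS.
have step m : (1 - z * q ^+ m) * B m = (1 - a * z * q ^+ m) * B m.+1.
  rewrite mulrBl mul1r; set y := z * q ^+ m.
  have hBm : sums (phi_term a y 1 q) (B m) := hB m.
  have hBm' : sums (phi_term a (y * q) 1 q) (B m.+1).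
    by move: (hB m.+1); rewrite exprSr mulrA.
  have h := tendsD (tends_shift hBm) (tendsN (tendsM (tends_cst y) hBm)).
  apply: (tends_uniq h).
  have h' := tendsD (tends_shift hBm')
    (tendsN (tendsM (tends_cst (a * y)) hBm')).
  rewrite -mulrA -/y mulrBl mul1r; apply: tends_ext h' => n; rewrite !mulr_sumr.
  elim: n => [|n IH].
    by rewrite !big_ord_recr !big_ord0 /= subr0 !phi_term0.
  rewrite [X in X - _]big_ord_recr [X in _ - X]big_ord_recr /= opprD addrACA IH.
  rewrite [X in _ = X - _]big_ord_recr [X in _ = _ - X]big_ord_recr /= opprD.
  rewrite [RHS]addrACA; congr (_ + _).
  have h1 := one_sub_neq0 (norm_exprS_lt1 n q1); have h2 := qpoch_neq0 n q1.
  rewrite !phi_termS // /phi_term !exprMn !expr1n exprS.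
  by rewrite exprS in h1; field; rewrite h1 h2.
have B0 n : qpoch z q n * B 0%N = qpoch (a * z) q n * B n.
  elim: n => [|n IH]; first by rewrite !qpoch0.
  rewrite !qpochS mulrAC IH -[LHS]mulrA -[RHS]mulrA -step.
  by congr (_ * _); exact: mulrC.
have B1 : tends B 1.
  apply: (phi_sum_tends (a := fun=> a) (b := a) (x := fun n => z * q ^+ n)
    (y := z) (p := 1) (q := q) (a0 := a) (x0 := 0) (l := `|z|)) => //.
  - by rewrite normr1; apply: dec.
  - by rewrite normr_id.
  - by move=> n; rewrite normrM normrX ler_piMr // exprn_ile1 // ltW.
  - exact: tends_cst.
  - by rewrite -(mulr0 z); apply: tendsM (tends_cst _) (tends_expr0 q1).
  (* At argument 0 only the term of index 0 survives, so the partial sums equal 1 as soon as they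
     are nonempty. *)
  - apply: (tends_near (N := 1) _ (tends_cst 1)) => -[//|n] _.
    rewrite big_ord_recl phi_term0 big1 ?addr0 // => i _.
    by rewrite /phi_term lift0 expr0n /= !mulr0.
exists (B 0%N); first by have := hB 0%N; rewrite expr0 mulr1.
rewrite -[RHS]mulr1.
apply: (tends_uniq (tendsM (qpoch_tends z q1) (tends_cst (B 0%N)))).
apply: (tends_ext (fun n => esym (B0 n))).
exact: tendsM (qpoch_tends _ q1) B1.
Qed.

(** The case [a = 0] of [qbinomial_mul] exhibits an inverse: the product times the series is 1. *)
Lemma qpoch_infty_neq0 {R : realType} {q z : R[i]} :
  `|q| < 1 -> `|z| < 1 -> qpoch_infty z q != 0.
Proof.
move=> q1 z1; have [S _] := qbinomial_mul 0 q1 z1; rewrite mul0r qpoch_infty0.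
by apply: contra_eq_neq => ->; rewrite mul0r eq_sym oner_neq0.
Qed.

Lemma qbinomial {R : realType} (a : R[i]) {q z : R[i]} :
  `|q| < 1 -> `|z| < 1 ->
  sums (phi_term a z 1 q) (qpoch_infty (a * z) q / qpoch_infty z q).
Proof.
move=> q1 z1; have [S hS <-] := qbinomial_mul a q1 z1.
by rewrite mulrC mulKf ?qpoch_infty_neq0.
Qed.

(* The sum [L] satisfies [L A = (1 - A * q) * L (A * q ^+ 2)]: the difference of
   the two sides telescopes. *)
Lemma lebesgue_identity {R : realType} (A : R[i]) {q : R[i]} : `|q| < 1 ->
  sums (phi_term A q q q) (qpoch_infty (- q) q * qpoch_infty (A * q) (q ^+ 2)).
Proof.
move=> q1.
have q21 : `|q ^+ 2| < 1 by exact: norm_exprS_lt1.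
have nlt : `|0 : R[i]| < 1 by rewrite normr0 ltr01.
have /choice[L hL] : forall a, exists l, sums (phi_term a q q q) l.
  move=> a.
  have [S hS] := phi_term_summable (a := a) q1 (tends_geometric0 q q1) nlt.
  exact: sums_abs hS.
have step a : L a = (1 - a * q) * L (a * q ^+ 2).
  have h := tendsD (tends_shift (hL a)) (tendsN (tendsM (tends_cst (1 - a * q))
     (tends_shift (hL (a * q ^+ 2))))).
  apply/subr0_eq; apply: (tends_uniq h).
  (* This is the closed form of the difference of the partial sums with [n + 1] terms; it vanishes
     in the limit. *)
  have h0 : tends (fun n => (q ^+ n * (a * q)) * phi_term (a * q) q q q n) 0.
    rewrite -(mul0r 0).
    exact: tendsM (tends_geometric0 _ q1) (sums_terms0 (hL (a * q))).
  apply: tends_ext h0 => n.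
  have qpoch2 k : (1 - a * q) * qpoch (a * q ^+ 2) q k = qpoch (a * q) q k.+1.
    by rewrite qpochSl mulrA.
  elim: n => [|n IH].
    by rewrite !big_ord_recr !big_ord0 /= !phi_term0; ring.
  rewrite big_ord_recr [X in _ - _ * X]big_ord_recr /= mulrDr opprD addrACA -IH.
  rewrite {IH} phi_termS //.
  (* Both new terms are expressed through the term of index [n] at [a * q], the one in the
     telescoped remainder. *)
  have -> : phi_term a q q q n.+1 =
      (1 - a) * (q ^+ n * q) * phi_term (a * q) q q q n / (1 - q ^+ n.+1).
    rewrite /phi_term qpochSl qpochS binS bin1 exprD !exprS.
    have h1 := one_sub_neq0 (norm_exprS_lt1 n q1); have h2 := qpoch_neq0 n q1.
    by rewrite exprS in h1; field; rewrite h1 h2.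
  have -> : (1 - a * q) * phi_term (a * q ^+ 2) q q q n.+1 =
      (1 - a * q * q ^+ n) * (1 - a * q * q ^+ n.+1) *
      (q ^+ n * q) * phi_term (a * q) q q q n / (1 - q ^+ n.+1).
    rewrite /phi_term 2!(mulrA (1 - a * q)) qpoch2 !qpochS binS bin1.
    rewrite exprD !exprS.
    have h1 := one_sub_neq0 (norm_exprS_lt1 n q1); have h2 := qpoch_neq0 n q1.
    by rewrite exprS in h1; field; rewrite h1 h2.
  have h1 := one_sub_neq0 (norm_exprS_lt1 n q1).
  by rewrite exprS in h1 *; field; rewrite h1.
have LE n : L A = qpoch (A * q) (q ^+ 2) n * L (A * (q ^+ 2) ^+ n).
  elim: n => [|n IH]; first by rewrite qpoch0 mul1r mulr1.
  rewrite IH qpochS step -!mulrA -exprSr; congr (_ * (_ * _)).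
  by rewrite [_ * q]mulrC.
have L0 : L 0 = qpoch_infty (- q) q.
  by apply: tends_uniq (hL 0) _; exact: (euler q q1).1.
have lim0 : tends (fun n => L (A * (q ^+ 2) ^+ n)) (qpoch_infty (- q) q).
  apply: (phi_sum_tends (a := fun n => A * (q ^+ 2) ^+ n) (b := A)
    (x := fun=> q) (y := q) (p := q) (q := q) (a0 := 0) (x0 := q)
    (l := 0)) => //.
  - by apply: tends_geometric0; rewrite normr_id.
  - move=> n; rewrite normrM ler_piMr // normrX exprn_ile1 // ltW //.
  - by rewrite -(mulr0 A); apply: tendsM (tends_cst _) (tends_expr0 q21).
  - exact: tends_cst.
  - by rewrite -L0.
have LA : L A = qpoch_infty (- q) q * qpoch_infty (A * q) (q ^+ 2).
  rewrite mulrC; apply: (tends_uniq (tends_cst (L A))).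
  apply: tends_ext (tendsM (qpoch_tends (A * q) q21) lim0) => n.
  by rewrite -LE.
by move: LA => <-; exact: hL.
Qed.

(** * The reparametrized summand and its majorant *)

(* The summand in the parameters [beta = b q^2 / c] and [z = b^2 q^2 / c],
   arranged so that all exponents are natural numbers and its [j]-dependence is
   that of an Euler series. *)
Definition cterm {R : realType} (q beta z : R[i]) (k i j : nat) : R[i] :=
  z ^+ k / qpoch (q ^+ 2) (q ^+ 2) k * (q ^+ 'C(i, 2) * q ^+ i / qpoch q q i)
  * ((- beta^-1) ^+ (k.*2 + i) * q ^+ 'C((k.*2 + i).+1, 2))
  * phi_term 0 (- (beta / q ^+ (k.*2 + i))) q q j.

Lemma bin2_int n : ('C(n, 2)%:Z * 2 = n%:Z ^+ 2 - n%:Z :> int)%R.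
Proof.
elim: n => [|n IH]; first by rewrite bin0n.
by move: IH; rewrite binS bin1 !expr2; lia.
Qed.

(** The summands [j.*2], [k.*2] and [- N.*2] are the powers of [q] hidden in [beta ^+ j], [z ^+ k]
    and [beta^-1 ^+ N]; [- N * j] comes from the division by [q ^+ N] in the Euler argument. *)
Lemma qexp_split (i j k : nat) (N := (k.*2 + i)%N) :
  qexp i j k = ('C(i, 2) + i + 'C(N.+1, 2) + 'C(j, 2) + j.*2 + k.*2)%N%:Z
    - (N * j + N.*2)%N%:Z.
Proof.
have := (qexpE i j k, bin2_int i, bin2_int N.+1, bin2_int j).
rewrite /qexp_num /N -!mul2n !expr2 => -[[[]]]; lia.
Qed.

Lemma triple_termE {R : realType} {q b c : R[i]} (i j k : nat) :
  `|q| < 1 -> q != 0 -> b != 0 -> c != 0 ->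
  triple_term q b c (i, j, k) =
    cterm q (b * q ^+ 2 / c) (b ^+ 2 * q ^+ 2 / c) k i j.
Proof.
move=> q1 q0 b0 c0.
have qpoch00 n : qpoch 0 q n = 1 :> R[i].
  by rewrite /qpoch big1 // => ? _; rewrite mul0r subr0.
rewrite /triple_term /cterm /phi_term qpoch00 qexp_split.
set N := (k.*2 + i)%N.
have zb : b ^ (- i%:Z + j%:Z) = b ^+ j / b ^+ i.
  by rewrite expfzDr // mulrC -exprnN.
have zc : c ^ (i%:Z - j%:Z + k%:Z) = c ^+ i / c ^+ j * c ^+ k.
  by rewrite !expfzDr // -exprnN.
have zq m n : q ^ (m%:Z - n%:Z) = q ^+ m / q ^+ n.
  by rewrite expfzDr // -exprnN.
(* [N] differs from [i] by the even number [k.*2]; the sign in [j] comes from the Euler argument. *)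
have sgn : (-1) ^+ N = (-1) ^+ i :> R[i].
  by rewrite -signr_odd oddD odd_double signr_odd.
move: 'C(i, 2) 'C(N.+1, 2) 'C(j, 2) => Ci CN Cj.
rewrite zb zc zq [(- _) ^+ N]exprNn [(- (_ / q ^+ N)) ^+ j]exprNn sgn.
rewrite !expr_div_n !exprVn !expr_div_n !exprMn -!exprM.
rewrite -!addnn !exprD; set Q := q ^+ (N * j).
rewrite /N -addnn !exprD.
have Q0 : Q != 0 by exact: expf_neq0.
have q21 : `|q ^+ 2| < 1 by exact: norm_exprS_lt1.
field.
by rewrite !expf_neq0 ?qpoch_neq0.
Qed.

(** With a negated norm for [beta], both [- beta^-1] and the Euler argument become nonnegative, so
    the majorant is again a [cterm] and the same summations apply to it. *)
Lemma norm_cterm_le {R : realType} {q : R[i]} (beta z : R[i]) k i j :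
  `|q| < 1 ->
  `|cterm q beta z k i j| <= cterm `|q| (- `|beta|) `|z| k i j.
Proof.
move=> q1; have q21 : `|q ^+ 2| < 1 by exact: norm_exprS_lt1.
rewrite /cterm normrM; apply: ler_pM; rewrite ?normr_ge0 //; last first.
  set N := (k.*2 + i)%N.
  have -> : - (- `|beta| / `|q| ^+ N) = `|- (beta / q ^+ N)|.
    by rewrite normrN normrM normfV normrX mulNr opprK.
  set y := - (beta / q ^+ N).
  have := phi_term_norm_le q j q1 (lexx `|0 : R[i]|) (lexx `|y|).
  by rewrite normr0 oppr0.
rewrite !normrM.
have inv_le p n : `|p| < 1 -> `|(qpoch p p n)^-1| <= (qpoch `|p| `|p| n)^-1.
  move=> p1; rewrite normfV lef_pV2 ?posrE ?qpoch_norm_gt0 //; last first.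
    by rewrite normr_gt0 qpoch_neq0.
  exact: norm_qpoch_ge.
apply: ler_pM; rewrite ?mulr_ge0 //; last first.
  by rewrite !normrX normrN normfV invrN opprK.
apply: ler_pM; rewrite ?mulr_ge0 //.
  rewrite normrX; apply: ler_wpM2l; first by rewrite exprn_ge0.
  by rewrite -normrX; exact: inv_le.
rewrite !normrX; apply: ler_wpM2l; first by rewrite mulr_ge0 ?exprn_ge0.
exact: inv_le.
Qed.

(** * Splitting and reversing q-Pochhammer products *)

Lemma qpoch_infty_split {R : realType} (a : R[i]) {q : R[i]} n : `|q| < 1 ->
  qpoch_infty a q = qpoch a q n * qpoch_infty (a * q ^+ n) q.
Proof.
move=> q1; apply: qpoch_infty_lim.
have h := tendsM (tends_cst (qpoch a q n)) (qpoch_tends (a * q ^+ n) q1).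
have {}h : tends (fun m => qpoch a q (n + m))
    (qpoch a q n * qpoch_infty (a * q ^+ n) q).
  by apply: tends_ext h => m; rewrite -qpochD.
apply/tendsP => e /(tendsP.1 h)[N hN]; exists (n + N)%N => m nm.
by have := hN (m - n)%N; rewrite subnKC ?leq_subRL; [apply| | ]; lia.
Qed.

(** Factor by factor, [1 - beta / q ^+ m] is [- beta / q ^+ m] times [1 - q ^+ m / beta], for [m]
    from 1 to [n]; the prefactor cancels the monomials. *)
Lemma qpoch_reflect {R : realType} {beta q : R[i]} n : q != 0 -> beta != 0 ->
  (- beta^-1) ^+ n * q ^+ 'C(n.+1, 2) * qpoch (beta / q ^+ n) q n =
  qpoch (q / beta) q n.
Proof.
move=> q0 beta0; elim: n => [|n IH]; first by rewrite !qpoch0 !mulr1.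
rewrite qpochSl qpochS -IH exprS binS bin1 exprD.
have -> : beta / q ^+ n.+1 * q = beta / q ^+ n.
  by rewrite exprS; field; rewrite q0 expf_neq0.
by rewrite !exprS; field; rewrite q0 beta0 expf_neq0.
Qed.

Lemma qpoch_double {R : realType} (a q : R[i]) n :
  qpoch a q n.*2 = qpoch a (q ^+ 2) n * qpoch (a * q) (q ^+ 2) n.
Proof.
elim: n => [|n IH]; first by rewrite !qpoch0 mulr1.
rewrite doubleS !qpochS IH -!exprM mul2n !exprS; ring.
Qed.

(** * From iterated sums to unconditional summation *)

(** Setting the terms to zero from index [n] on lets the length of the sum vary together with its
    terms in [tannery]. *)
Lemma tannery_partial {R : realType} {u : nat -> nat -> R[i]}
    {v M : nat -> R[i]} {S V : R[i]} :
  sums M S -> (forall n i, `|u n i| <= M i) ->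
  (forall i, tends (u^~ i) (v i)) -> sums v V ->
  tends (fun n => \sum_(i < n) u n i) V.
Proof.
move=> hM uM uv vV.
apply: (tannery (u := fun n i => if (i < n)%N then u n i else 0)
  (U := fun n => \sum_(i < n) u n i) hM _ _ _ vV).
- move=> n i; case: ifP => _; first exact: uM.
  by rewrite normr0; apply: le_trans (normr_ge0 (u 0%N i)) (uM 0%N i).
- by move=> i; apply: (tends_near (N := i.+1) _ (uv i)) => n /= ->.
- move=> n; apply: (tends_near (N := n) _ (tends_cst (\sum_(i < n) u n i))).
  move=> m nm.
  rewrite (big_ord_widen_cond _ (fun=> true) (u n) nm) big_mkcond /=.
  exact: eq_bigr.
Qed.

(** Dominated convergence is used twice, over [k] with majorant [H] and inside over [i] with
    majorant [G k]; the partial sums of the nonnegative [g] stay below these iterated sums. *)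
Lemma tends_box {R : realType} {t g : nat -> nat -> nat -> R[i]}
    {W G : nat -> nat -> R[i]} {X H : nat -> R[i]} {l m : R[i]} :
  (forall k i j, `|t k i j| <= g k i j) ->
  (forall k i, sums (t k i) (W k i)) -> (forall k, sums (W k) (X k)) ->
  sums X l ->
  (forall k i, sums (g k i) (G k i)) -> (forall k, sums (G k) (H k)) ->
  sums H m ->
  tends (fun n => \sum_(k < n) \sum_(i < n) \sum_(j < n) t k i j) l.
Proof.
move=> tg hW hX hl hG hH hm.
have g0 k i j : 0 <= g k i j := le_trans (normr_ge0 _) (tg k i j).
have tG n k i : `|\sum_(j < n) t k i j| <= G k i.
  apply: le_trans (ler_norm_sum _ _ _) _.
  apply: le_trans (sums_ge_partial n (g0 k i) (hG k i)).
  by apply: ler_sum => j _; exact: tg.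
have G0 k i : 0 <= G k i := le_trans (normr_ge0 _) (tG 0%N k i).
apply: (tannery_partial (u := fun n k => \sum_(i < n) \sum_(j < n) t k i j)
  hm _ _ hl) => [n k|k].
  apply: le_trans (ler_norm_sum _ _ _) _.
  apply: le_trans (sums_ge_partial n (G0 k) (hH k)).
  by apply: ler_sum => i _; exact: tG.
apply: (tannery_partial (u := fun n i => \sum_(j < n) t k i j)
  (hH k) _ _ (hX k)).
  by move=> n i; exact: tG.
by move=> i; exact: hW.
Qed.

(** A finite set [T] containing [B N] lies in some later [B p], so its sum differs from that over
    [B N] by at most the [g]-mass of the difference of the two exhausting sets, which is small by
    convergence along [B]. *)
Lemma has_sum_exhaust {R : realType} {I : choiceType} {f g : I -> R[i]}
    {B : nat -> {fset I}} {l m : R[i]} :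
  (forall x, `|f x| <= g x) ->
  (forall n p, (n <= p)%N -> (B n `<=` B p)%fset) ->
  (forall x, exists n, x \in B n) ->
  tends (fun n => \sum_(x <- B n) f x) l ->
  tends (fun n => \sum_(x <- B n) g x) m ->
  has_sum f l.
Proof.
move=> fg Bmono Bex /tendsP hf /tendsP hg.
have split (h : I -> R[i]) (A T : {fset I}) : (A `<=` T)%fset ->
    \sum_(x <- T) h x - \sum_(x <- A) h x = \sum_(x <- (T `\` A)%fset) h x.
  move=> AT; rewrite (big_fsetID _ (mem A) T) /=.
  have -> : [fset x in T | x \in A]%fset = A.
    apply/fsetP => x; rewrite !inE /=; apply/andP/idP => [[]//|xA].
    by split=> //; exact: (fsubsetP AT).
  have -> : [fset x in T | x \notin A]%fset = (T `\` A)%fset.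
    by apply/fsetP => x; rewrite !inE /= andbC.
  by rewrite [X in X - _]addrC addrK.
have absorb (T : {fset I}) : exists n, (T `<=` B n)%fset.
  have [d hd] := choice Bex; exists (\max_(x <- T) d x).
  apply/fsubsetP => x xT; apply: (fsubsetP _ _ (hd x)); apply: Bmono.
  exact: leq_bigmax_seq.
have totallyF : Filter (@summability.totally I).
  by have := @summability.totally_filter I => -[].
apply/cvgrPdist_lt => e e0; have e20 : 0 < e / 2 by rewrite divr_gt0.
have e40 : 0 < e / 2 / 2 by rewrite !divr_gt0.
have [N1 h1] := hf _ e20; have [N2 h2] := hg _ e40.
pose N := maxn N1 N2; exists (B N) => // T /= BT.
have [p Tp] := absorb T.
have NP : (N <= maxn N p)%N by exact: leq_maxl.
have TP : (T `<=` B (maxn N p))%fset.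
  by apply: fsubset_trans Tp (Bmono _ _ (leq_maxr _ _)).
rewrite distrC /summability.partial_sum -(big_seq_fsetE _ _ predT f) /=.
have -> : \sum_(x <- T) f x - l =
  (\sum_(x <- T) f x - \sum_(x <- B N) f x) + (\sum_(x <- B N) f x - l) by ring.
apply: le_lt_trans (ler_normD _ _) _; rewrite [ltRHS](splitr e).
apply: ltrD; last by apply: h1; exact: leq_maxl.
rewrite split //; apply: le_lt_trans (ler_norm_sum _ _ _) _.
have g0 x : 0 <= g x := le_trans (normr_ge0 _) (fg x).
apply: (@le_lt_trans _ _ (\sum_(x <- (B (maxn N p) `\` B N)%fset) g x)).
  apply: (@le_trans _ _ (\sum_(x <- (T `\` B N)%fset) g x)).
    by apply: ler_sum => x _; exact: fg.
  rewrite -!split ?(fsubset_trans BT) // lerD2r -subr_ge0 split //.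
  by apply: sumr_ge0.
rewrite -split ?Bmono //.
have -> : \sum_(x <- B (maxn N p)) g x - \sum_(x <- B N) g x =
  (\sum_(x <- B (maxn N p)) g x - m) - (\sum_(x <- B N) g x - m) by ring.
rewrite -[ltLHS]ger0_norm; last first.
  have -> : \sum_(x <- B (maxn N p)) g x - m - (\sum_(x <- B N) g x - m) =
    \sum_(x <- B (maxn N p)) g x - \sum_(x <- B N) g x by ring.
  by rewrite split ?Bmono //; apply: sumr_ge0.
apply: le_lt_trans (ler_normB _ _) _; rewrite [ltRHS](splitr (e / 2)).
apply: ltrD; apply: h2; last exact: leq_maxr.
by apply: leq_trans NP; exact: leq_maxr.
Qed.

(** The listing runs over [k], then [i], then [j], as in [tends_box], while the entries are stored
    in the order of [triple_term]. *)
Definition cube (n : nat) : {fset nat * nat * nat} :=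
  [fset x in [seq (p.2, j, p.1) |
    p <- [seq (k, i) | k <- iota 0 n, i <- iota 0 n], j <- iota 0 n]]%fset.

Lemma in_cube n (x : nat * nat * nat) :
  (x \in cube n) = [&& x.1.1 < n, x.1.2 < n & x.2 < n]%N.
Proof.
rewrite in_fset /=; apply/allpairsP/idP.
  case=> -[p j] [/allpairsP[[k i] [/=]]]; rewrite !mem_iota => hk hi ->.
  by move=> hj -> /=; lia.
case: x => [[i j] k] /= h; exists ((k, i), j); split=> //.
  by apply: allpairs_f; rewrite mem_iota; lia.
by rewrite mem_iota /=; lia.
Qed.

Lemma cube_mono n p : (n <= p)%N -> (cube n `<=` cube p)%fset.
Proof. by move=> np; apply/fsubsetP => x; rewrite !in_cube; lia. Qed.

Lemma cube_cover x : exists n, x \in cube n.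
Proof.
by case: x => [[i j] k]; exists (i + j + k).+1; rewrite in_cube /=; lia.
Qed.

Lemma sum_cube {V : zmodType} (f : nat * nat * nat -> V) n :
  \sum_(x <- cube n) f x =
  \sum_(k < n) \sum_(i < n) \sum_(j < n)
    f (nat_of_ord i, nat_of_ord j, nat_of_ord k).
Proof.
transitivity (\sum_(x <- [seq (p.2, j, p.1) |
    p <- [seq (k, i) | k <- iota 0 n, i <- iota 0 n], j <- iota 0 n]) f x).
  apply: perm_big; apply: uniq_perm; first exact: fset_uniq.
    apply: allpairs_uniq; rewrite ?iota_uniq //.
      apply: allpairs_uniq; rewrite ?iota_uniq //.
      by move=> [? ?] [? ?] _ _ /= [-> ->].
    by move=> [[? ?] ?] [[? ?] ?] _ _ /= [-> -> ->].
  by move=> x; rewrite in_fset.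
have iotaE (F : nat -> V) : \sum_(k <- iota 0 n) F k = \sum_(k < n) F k.
  by rewrite -(big_mkord predT) /index_iota subn0.
rewrite !big_allpairs_dep iotaE; apply: eq_bigr => k _.
rewrite iotaE; apply: eq_bigr => i _.
by rewrite iotaE.
Qed.

(** * The successive sums over [j], [i] and [k] *)

(** Euler's product at [beta / q ^+ N] is split after [N] factors: the tail is the product at
    [beta], and the first factors are reversed by [qpoch_reflect]. *)
Lemma cterm_sum_j {R : realType} {q beta : R[i]} (z : R[i]) k i : `|q| < 1 ->
  q != 0 -> beta != 0 ->
  sums (cterm q beta z k i)
    (z ^+ k / qpoch (q ^+ 2) (q ^+ 2) k * (q ^+ 'C(i, 2) * q ^+ i / qpoch q q i)
     * (qpoch (q / beta) q (k.*2 + i) * qpoch_infty beta q)).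
Proof.
move=> q1 q0 beta0; set N := (k.*2 + i)%N.
set w := z ^+ k / _ * _.
have h := sumsZ (a := w * ((- beta^-1) ^+ N * q ^+ 'C(N.+1, 2)))
  (euler (- (beta / q ^+ N)) q1).1.
have <- : w * ((- beta^-1) ^+ N * q ^+ 'C(N.+1, 2))
    * qpoch_infty (- - (beta / q ^+ N)) q =
    w * (qpoch (q / beta) q N * qpoch_infty beta q).
  rewrite opprK -(qpoch_reflect N q0 beta0).
  rewrite (qpoch_infty_split (beta / q ^+ N) N q1).
  have -> : beta / q ^+ N * q ^+ N = beta by rewrite divfK ?expf_neq0.
  by rewrite !mulrA.
exact: sums_ext h.
Qed.

(** Removing the first [k.*2] factors leaves Lebesgue's series at [a * q ^+ k.*2]. By
    [qpoch_double], the odd half of the removed factors completes the resulting product in base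
    [q ^+ 2], and the even half is the numerator of the q-binomial term. *)
Lemma cterm_sum_i {R : realType} {q beta : R[i]} (z : R[i]) k : `|q| < 1 ->
  sums (fun i => z ^+ k / qpoch (q ^+ 2) (q ^+ 2) k *
      (q ^+ 'C(i, 2) * q ^+ i / qpoch q q i)
     * (qpoch (q / beta) q (k.*2 + i) * qpoch_infty beta q))
   (qpoch_infty beta q * qpoch_infty (- q) q *
     qpoch_infty (q / beta * q) (q ^+ 2) * phi_term (q / beta) z 1 (q ^+ 2) k).
Proof.
move=> q1; have q21 : `|q ^+ 2| < 1 by exact: norm_exprS_lt1.
set a := q / beta.
have h := sumsZ (a := z ^+ k / qpoch (q ^+ 2) (q ^+ 2) k * qpoch_infty beta q *
  qpoch a q k.*2) (lebesgue_identity (a * q ^+ k.*2) q1).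
have <- : z ^+ k / qpoch (q ^+ 2) (q ^+ 2) k * qpoch_infty beta q *
   qpoch a q k.*2 *
   (qpoch_infty (- q) q * qpoch_infty (a * q ^+ k.*2 * q) (q ^+ 2)) =
   qpoch_infty beta q * qpoch_infty (- q) q *
     qpoch_infty (a * q) (q ^+ 2) * phi_term a z 1 (q ^+ 2) k.
  rewrite (qpoch_infty_split (a * q) k q21) qpoch_double /phi_term expr1n.
  have -> : a * q ^+ k.*2 * q = a * q * (q ^+ 2) ^+ k.
    by rewrite -exprM mul2n mulrAC.
  move: (qpoch_infty beta q) (qpoch_infty (- q) q) => x1 x2.
  move: (qpoch_infty _ _) (qpoch a _ k) => x3 x4.
  move: (qpoch (a * q) _ k) (qpoch _ _ k)^-1 => x5 x6.
  by ring.
apply: sums_ext h => i; rewrite /phi_term qpochD.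
by ring.
Qed.

Lemma cterm_sum_k {R : realType} {q beta z : R[i]} : `|q| < 1 -> `|z| < 1 ->
  sums (fun k => qpoch_infty beta q * qpoch_infty (- q) q *
     qpoch_infty (q / beta * q) (q ^+ 2) * phi_term (q / beta) z 1 (q ^+ 2) k)
   (qpoch_infty beta q * qpoch_infty (- q) q *
     qpoch_infty (q / beta * q) (q ^+ 2) *
     (qpoch_infty (q / beta * z) (q ^+ 2) / qpoch_infty z (q ^+ 2))).
Proof.
move=> q1 z1; apply: sumsZ; apply: qbinomial => //; exact: norm_exprS_lt1.
Qed.

(** * Identification of the closed form and passage to the triple series *)

Lemma qpochs_infty2 {R : realType} (a b q : R[i]) :
  qpochs_infty [:: a; b] q = qpoch_infty a q * qpoch_infty b q.
Proof. by rewrite /qpochs_infty big_cons big_seq1. Qed.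

Theorem theorem4p3 (R : realType) (q b c : R[i]) :
  0 < `|q| -> `|q| < 1 -> b != 0 -> c != 0 ->
  `|b ^+ 2 * q ^+ 2| < `|c| ->
  has_sum (triple_term q b c)
    (qpochs_infty [:: - q; b * q ^+ 2 / c] q
       * qpochs_infty [:: b * q; c / b] (q ^+ 2)
     / qpoch_infty (b ^+ 2 * q ^+ 2 / c) (q ^+ 2)).
Proof.
rewrite normr_gt0 => q0 q1 b0 c0 bqc.
set beta := b * q ^+ 2 / c; set z := b ^+ 2 * q ^+ 2 / c.
have beta0 : beta != 0 by rewrite !mulf_neq0 ?invr_neq0 ?expf_neq0.
have z1 : `|z| < 1 by rewrite normrM normfV ltr_pdivrMr ?normr_gt0 // mul1r.
have q1' : `| `|q| | < 1 by rewrite normr_id.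
have q0' : `|q| != 0 by rewrite normr_eq0.
have beta0' : - `|beta| != 0 by rewrite oppr_eq0 normr_eq0.
have z1' : `| `|z| | < 1 by rewrite normr_id.
have lhs := tends_box (fun k i j => norm_cterm_le beta z k i j q1)
  (fun k i => cterm_sum_j z k i q1 q0 beta0)
  (fun k => cterm_sum_i z k q1) (cterm_sum_k q1 z1)
  (fun k i => cterm_sum_j `|z| k i q1' q0' beta0')
  (fun k => cterm_sum_i `|z| k q1') (cterm_sum_k q1' z1').
(* The majorant dominates itself, so [tends_box] applies to it as well; [has_sum_exhaust] needs the
   convergence of its sums over cubes. *)
have g_norm k i j : `|cterm `|q| (- `|beta|) `|z| k i j|
    <= cterm `|q| (- `|beta|) `|z| k i j.
  have := norm_cterm_le (- `|beta|) `|z| k i j q1'.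
  by rewrite normrN !normr_id.
have maj := tends_box g_norm
  (fun k i => cterm_sum_j `|z| k i q1' q0' beta0')
  (fun k => cterm_sum_i `|z| k q1') (cterm_sum_k q1' z1')
  (fun k i => cterm_sum_j `|z| k i q1' q0' beta0')
  (fun k => cterm_sum_i `|z| k q1') (cterm_sum_k q1' z1').
have limE : qpochs_infty [:: - q; beta] q *
     qpochs_infty [:: b * q; c / b] (q ^+ 2) / qpoch_infty z (q ^+ 2) =
   qpoch_infty beta q * qpoch_infty (- q) q *
     qpoch_infty (q / beta * q) (q ^+ 2) *
     (qpoch_infty (q / beta * z) (q ^+ 2) / qpoch_infty z (q ^+ 2)).
  have -> : q / beta * q = c / b by rewrite /beta; field; rewrite b0 c0 q0.
  have -> : q / beta * z = b * q by rewrite /beta /z; field; rewrite b0 c0 q0.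
  rewrite !qpochs_infty2.
  move: (qpoch_infty (- q) q) (qpoch_infty beta q) (qpoch_infty (c / b) _).
  move: (qpoch_infty (b * q) _) (qpoch_infty z _)^-1 => x1 x2 x3 x4 x5.
  by ring.
move: limE => ->.
pose g (x : nat * nat * nat) := cterm `|q| (- `|beta|) `|z| x.2 x.1.1 x.1.2.
apply: (has_sum_exhaust (g := g) (B := cube)).
- move=> [[i j] k]; move: (triple_termE i j k q1 q0 b0 c0) => ->.
  exact: norm_cterm_le.
- exact: cube_mono.
- exact: cube_cover.
- apply: tends_ext lhs => n; rewrite sum_cube.
  apply: eq_bigr => k _; apply: eq_bigr => i _; apply: eq_bigr => j _.
  exact: (esym (triple_termE i j k q1 q0 b0 c0)).
- by apply: tends_ext maj => n; rewrite sum_cube.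
Qed.
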